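(* Assume $\delta=\min_{x\in\mathcal{X},\,x\ne0}\sum_{i}\mu_i(x_i)-\sum_i\lambda_i>0$. Then the coupling time $\tau^T$ of the ATO-TOS system with individual state-dependent replenishments satisfies $$\mathbb{E}[\tau^T]\le\frac{\Lambda}{\delta}|C|,\qquad\text{where } |C|=\sum_{i=1}^I C_i .$$
   Context: Let $I\ge 1$ be an integer, $\mathcal{I}=\{1,\dots,I\}$, and let $C_1,\dots,C_I$ be positive integers. The state space is $\mathcal{X}=\{0,\dots,C_1\}\times\cdots\times\{0,\dots,C_I\}$. Let $e_i$ be the vector with all components $0$ except the $i$-th, equal to $1$, and $e_A=\sum_{i\in A}e_i$ for $A\subset\mathcal{I}$. Rates: for each nonempty $A\subset\mathcal{I}$ let $\lambda_A\ge0$ be the arrival rate of demands for $A$; $\lambda=\sum_A\lambda_A$ and $\lambda_i=\sum_{A\ni i}\lambda_A$. For each $i\in\mathcal{I}$, $\mu_i:\{0,\dots,C_i\}\to[0,\infty)$ with $\mu_i(0)=0$ and $\mu_i(x)>0$ for $x\ge 1$. Put $\beta_i=\max_{1\le x\le C_i}\mu_i(x)$ and $\Lambda=\lambda+\sum_{i\in\mathcal{I}}\beta_i$. Let $(\ell_i^{(0)},\dots,\ell_i^{(C_i)})$ be an ordering of $\{0,\dots,C_i\}$ with $0=\mu_i(\ell_i^{(0)})\le\dots\le\mu_i(\ell_i^{(C_i)})=\beta_i$. Events: $\mathcal{E}=\{d_A:\emptyset\ne A\subset\mathcal{I}\}\cup\{s_i^{(j)}:i\in\mathcal{I},1\le j\le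 C_i\}$ with probability distribution $\nu(d_A)=\lambda_A/\Lambda$, $\nu(s_i^{(j)})=[\mu_i(\ell_i^{(j)})-\mu_i(\ell_i^{(j-1)})]/\Lambda$. The transition function $f_T:\mathcal{X}\times\mathcal{E}\to\mathcal{X}$ of the ATO-TOS (total order service) system is $$f_T(x,d_A)=x+\Big(\prod_{i\in A}\mathbf{1}_{\{x_i<C_i\}}\Big)e_A,\qquad f_T(x,s_i^{(j)})=x-\sum_{k=j}^{C_i}\mathbf{1}_{\{x_i=\ell_i^{(k)}\}}e_i .$$ It is extended to words of events by applying the events successively from left to right, and to subsets $U\subset\mathcal{X}$ by $f_T(U,w)=\{f_T(x,w):x\in U\}$. Let $(a_{-t})_{t\in\mathbb{N}}=(a_0,a_{-1},a_{-2},\dots)$ be i.i.d. events with distribution $\nu$, and $a_{-t+1\to0}=a_{-t+1}a_{-t+2}\cdots a_0$. The coupling time is $\tau^T=\min\{t:|f_T(\mathcal{X},a_{-t+1\to0})|=1\}$. *)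

(* Defs.v *)
From HB Require Import structures.
From mathcomp Require Import all_boot all_order all_algebra fingroup perm.
From mathcomp Require Import all_classical all_reals all_analysis.
Set Implicit Arguments.
Unset Strict Implicit.
Unset Printing Implicit Defensive.
Import Order.TTheory GRing.Theory Num.Theory.
Local Open Scope ring_scope.

(* Items are indexed by 'I_n (from 0), item i has capacity C i, and levels
   {0, ..., C i} are 'I_(C i).+1. *)

Definition state (n : nat) (C : 'I_n -> nat) :=
  {dffun forall i : 'I_n, 'I_(C i).+1}.

Definition state0 (n : nat) (C : 'I_n -> nat) : state C :=
  [ffun i : 'I_n => (ord0 : 'I_(C i).+1)].

Definition state_full (n : nat) (C : 'I_n -> nat) : state C :=
  [ffun i : 'I_n => (ord_max : 'I_(C i).+1)].

(* inl A is the demand d_A.  In inr (Tagged _ j), with j : 'I_(C i), services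
   are numbered from 0: it is s_i^(j+1). *)
Definition event (n : nat) (C : 'I_n -> nat) :=
  ({A : {set 'I_n} | A != finset.set0} + {i : 'I_n & 'I_(C i)})%type.

Definition total_arrival (R : realType) (n : nat) (lam : {set 'I_n} -> R) : R :=
  \sum_(A : {set 'I_n} | A != finset.set0) lam A.

Definition arrival (R : realType) (n : nat) (lam : {set 'I_n} -> R)
    (i : 'I_n) : R :=
  \sum_(A : {set 'I_n} | i \in A) lam A.

(* The default value 0 of the maximum is irrelevant when C i >= 1 and mu i is
   nonnegative. *)
Definition max_rate (R : realType) (n : nat) (C : 'I_n -> nat)
    (mu : forall i : 'I_n, 'I_(C i).+1 -> R) (i : 'I_n) : R :=
  \big[Num.max/0]_(x : 'I_(C i).+1 | (1 <= x)%N) mu i x.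

Definition unif_rate (R : realType) (n : nat) (C : 'I_n -> nat)
    (lam : {set 'I_n} -> R) (mu : forall i : 'I_n, 'I_(C i).+1 -> R) : R :=
  total_arrival lam + \sum_(i < n) max_rate mu i.

Definition service_rate (R : realType) (n : nat) (C : 'I_n -> nat)
    (mu : forall i : 'I_n, 'I_(C i).+1 -> R) (x : state C) : R :=
  \sum_(i < n) mu i (x i).

(* The iterated minimum starts from the value at state_full, which is itself a
   nonzero state when n >= 1 and all C i >= 1, so this is the true minimum. *)
Definition drift (R : realType) (n : nat) (C : 'I_n -> nat)
    (lam : {set 'I_n} -> R) (mu : forall i : 'I_n, 'I_(C i).+1 -> R) : R :=
  \big[Num.min/service_rate mu (state_full C)]_(x : state C | x != state0 C)
     service_rate mu x
  - \sum_(i < n) arrival lam i.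

(* ell i k is the level l_i^(k); as a permutation it lists every level once.
   The endpoint values of mu i along the ordering are then forced to be 0 and
   max_rate mu i. *)
Definition rate_ordering (R : realType) (n : nat) (C : 'I_n -> nat)
    (mu : forall i : 'I_n, 'I_(C i).+1 -> R)
    (ell : forall i : 'I_n, {perm 'I_(C i).+1}) : Prop :=
  forall (i : 'I_n) (j k : 'I_(C i).+1),
    (j <= k)%N -> mu i (ell i j) <= mu i (ell i k).

(* For j : 'I_(C i), lift ord0 j is j + 1 and widen_ord (leqnSn _) j is j, both
   as elements of 'I_(C i).+1. *)
Definition event_prob (R : realType) (n : nat) (C : 'I_n -> nat)
    (lam : {set 'I_n} -> R) (mu : forall i : 'I_n, 'I_(C i).+1 -> R)
    (ell : forall i : 'I_n, {perm 'I_(C i).+1}) (e : event C) : R :=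
  match e with
  | inl A => lam (val A) / unif_rate lam mu
  | inr (existT i j) =>
      (mu i (ell i (lift ord0 j)) - mu i (ell i (widen_ord (leqnSn (C i)) j)))
      / unif_rate lam mu
  end.

Definition served (n : nat) (C : 'I_n -> nat)
    (ell : forall i : 'I_n, {perm 'I_(C i).+1}) (x : state C)
    (i : 'I_n) (j : 'I_(C i)) : nat :=
  (\sum_(k : 'I_(C i).+1 | (j.+1 <= k)%N) (x i == ell i k))%N.

(* The arithmetic is done in nat and cast back by inord, without overflow or
   truncated subtraction: see tos_step_demand and tos_step_service below. *)
Definition tos_step (n : nat) (C : 'I_n -> nat)
    (ell : forall i : 'I_n, {perm 'I_(C i).+1})
    (x : state C) (e : event C) : state C :=
  match e with
  | inl A =>
      [ffun i : 'I_n =>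
        (inord (x i + (\prod_(k in val A) (x k < C k)%N) * (i \in val A))
          : 'I_(C i).+1)]
  | inr (existT i0 j) =>
      [ffun i : 'I_n =>
        (inord (x i - served ell x j * (i == i0)) : 'I_(C i).+1)]
  end.

Definition tos_word (n : nat) (C : 'I_n -> nat)
    (ell : forall i : 'I_n, {perm 'I_(C i).+1})
    (x : state C) (w : seq (event C)) : state C :=
  foldl (tos_step ell) x w.

Definition tos_image (n : nat) (C : 'I_n -> nat)
    (ell : forall i : 'I_n, {perm 'I_(C i).+1})
    (U : {set state C}) (w : seq (event C)) : {set state C} :=
  [set tos_word ell x w | x in U].

(* A sequence a : nat -> E stands for (a_0, a_(-1), a_(-2), ...), i.e. a k is
   the event at time -k; the word below is a_(-t+1) ... a_(-1) a_0. *)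
Definition past_word (E : Type) (a : nat -> E) (t : nat) : seq E :=
  [seq a k | k <- rev (iota 0 t)].

(* The least coupling t, valued in \bar R; it is +oo if there is none. *)
Definition coupling_time (R : realType) (n : nat) (C : 'I_n -> nat)
    (ell : forall i : 'I_n, {perm 'I_(C i).+1}) (a : nat -> event C) : \bar R :=
  ereal_inf [set (t%:R : R)%:E | t in
    [set t : nat | #|tos_image ell [set: state C] (past_word a t)| = 1%N]]%classic.

(* Random elements of the finite type E, with its discrete sigma-algebra. *)
Definition iid_with_law (d : measure_display) (T : measurableType d)
    (R : realType) (P : probability T R) (E : finType)
    (a : nat -> T -> E) (nu : E -> R) : Prop :=
  [/\ forall (t : nat) (B : set E), measurable (a t @^-1` B)%classic,
      forall (t : nat) (e : E), P (a t @^-1` [set e])%classic = (nu e)%:E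
    & forall (s : seq nat) (B : nat -> set E), uniq s ->
        P (\bigcap_(t in [set` s]) (a t @^-1` B t))%classic =
        (\prod_(t <- s) P (a t @^-1` B t)%classic)%E].

Lemma tos_step_demand (n : nat) (C : 'I_n -> nat)
    (ell : forall i : 'I_n, {perm 'I_(C i).+1}) (x : state C)
    (A : {A : {set 'I_n} | A != finset.set0}) (i : 'I_n) :
  (tos_step ell x (inl A) i : nat) =
  (x i + (\prod_(k in val A) (x k < C k)%N) * (i \in val A))%N.
Proof.
rewrite ffunE inordK //.
case: (boolP (i \in val A)) => iA; last by rewrite muln0 addn0.
rewrite (bigD1 i) //= muln1; case: (boolP (x i < C i)%N) => xi; last first.
  by rewrite mul0n addn0.
rewrite mul1n ltnS; apply: leq_trans xi.
rewrite -[X in (_ <= X)%N]addn1 leq_add2l.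
by elim/big_rec: _ => // k m _ mle; case: (x k < C k)%N; rewrite ?mul1n.
Qed.

Lemma tos_step_service (R : realType) (n : nat) (C : 'I_n -> nat)
    (mu : forall i : 'I_n, 'I_(C i).+1 -> R)
    (ell : forall i : 'I_n, {perm 'I_(C i).+1}) (x : state C)
    (i0 : 'I_n) (j : 'I_(C i0)) (i : 'I_n) :
  (forall i : 'I_n, mu i ord0 = 0) ->
  (forall (i : 'I_n) (y : 'I_(C i).+1), (1 <= y)%N -> 0 < mu i y) ->
  rate_ordering mu ell ->
  (tos_step ell x (inr (existT _ i0 j)) i + served ell x j * (i == i0))%N =
  x i :> nat.
Proof.
move=> mu0 mu_gt0 ell_le; rewrite ffunE.
have out : (x i - served ell x j * (i == i0) < (C i).+1)%N.
  by apply: leq_ltn_trans (ltn_ord (x i)); apply: leq_subr.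
rewrite inordK // subnK // {out}.
case: eqP => [->|_]; last by rewrite muln0.
rewrite muln1 /served.
pose k0 := ((ell i0)^-1)%g (x i0).
have k0E : ell i0 k0 = x i0 by rewrite /k0 permKV.
have eqk k : (x i0 == ell i0 k) = (k == k0).
  by rewrite -k0E (inj_eq perm_inj) eq_sym.
under eq_bigr => k _ do rewrite eqk.
case: (boolP (j.+1 <= k0)%N) => jk; last first.
  rewrite big1 // => k kj; case: eqP => // kk; by rewrite -kk kj in jk.
rewrite (bigD1 k0) //= eqxx big1 ?addn0; last first.
  by move=> k /andP[_ /negPf ->].
rewrite lt0n; apply/negP => /eqP x0.
have x00 : x i0 = ord0 by apply: val_inj.
pose z := ell i0 (ord0 : 'I_(C i0).+1).
have mz : mu i0 z <= 0.
  by rewrite -(mu0 i0) -x00 -k0E; apply: ell_le.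
have z0 : z = x i0.
  rewrite x00; apply: val_inj => /=; apply/eqP.
  by case: posnP => // /mu_gt0; rewrite ltNge mz.
by move: jk; rewrite /k0 -z0 /z permK.
Qed.

(* Main.v *)
(** A point m dominating U coordinatewise is pushed along by a chain which
    accepts every demand and serves item i only at s_i^(1).  All levels but 0
    have positive rate, so s_i^(1) serves all of them at once and the chain
    keeps dominating the image of U; once it reaches 0, the image is {0}.
    The event s_i^(1) has rate mu_i(l_i^(1)), which is the total service rate
    of a state with a single nonzero level and hence at least
    delta + sum_i lambda_i.  So as long as m <> 0, |m| decreases by at least
    delta / Lambda on average, and its mean hitting time of 0 from C is at most
    |C| Lambda / delta.  The tail of the coupling time is that of the forward
    coupling time, because the events are i.i.d. *)

Require Import Defs.
From HB Require Import structures.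
From mathcomp Require Import all_boot all_order all_algebra fingroup perm.
From mathcomp Require Import all_classical all_reals all_analysis.
Set Implicit Arguments.
Unset Strict Implicit.
Unset Printing Implicit Defensive.
Import Order.TTheory GRing.Theory Num.Theory.
Local Open Scope ring_scope.

(** * The law of the word of past events *)

(* The recursion is on the first letter because past_word grows on the left. *)
Fixpoint word_expect (R : realType) (E : finType) (nu : E -> R) (t : nat)
    (F : seq E -> R) : R :=
  if t is t'.+1 then \sum_e nu e * word_expect nu t' (fun w => F (e :: w))
  else F [::].

Lemma past_wordS (E : Type) (a : nat -> E) (t : nat) :
  past_word a t.+1 = a t :: past_word a t.
Proof. by rewrite /past_word -addn1 iotaD rev_cat. Qed.

Section IidWords.
Local Open Scope classical_set_scope.
Context {d : measure_display} {T : measurableType d} {R : realType}.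
Context {P : probability T R} {E : finType} {a : nat -> T -> E} {nu : E -> R}.
Hypothesis a_iid : iid_with_law P a nu.

Lemma past_word_split (S : seq E -> bool) (t : nat) :
  [set w | S (past_word (a ^~ w) t.+1)] =
  \bigcup_(e in [set: E]) (a t @^-1` [set e] `&`
    [set w | S (e :: past_word (a ^~ w) t)]).
Proof.
apply/seteqP; split=> w /=.
  by rewrite past_wordS => Sw; exists (a t w).
by case=> e _ [/= <-]; rewrite past_wordS.
Qed.

Lemma measurable_past_word (S : seq E -> bool) (t : nat) :
  measurable [set w | S (past_word (a ^~ w) t)].
Proof.
have [a_meas _ _] := a_iid.
elim: t S => [|t IH] S.
  rewrite [X in measurable X](_ : _ = [set _ | S [::]]) //.
  by case: (S [::]); rewrite ?set_true ?set_false.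
rewrite past_word_split; apply: fin_bigcup_measurable => // e _.
by apply: measurableI; [exact: a_meas | exact: (IH (fun w => S (e :: w)))].
Qed.

Lemma prob_bigcup_fin (F : E -> set T) :
  (forall e, measurable (F e)) -> trivIset [set: E] F ->
  P (\bigcup_(e in [set: E]) F e) = (\sum_e P (F e))%E.
Proof.
move=> F_meas F_triv; rewrite measure_fin_bigcup //; last exact: finite_finset.
have TE : [set: E] = [set` index_enum E].
  by apply/seteqP; split=> e //= _; exact: mem_index_enum.
by rewrite TE -fsbig_seq // index_enum_uniq.
Qed.

(** Independence is assumed for cylinder sets only, so the induction on [t] carries a cylinder over
    the older times [t], ..., [t + k - 1]; each step moves the oldest letter of the word into it.
    The law of the word is the case [k = 0]. *)
Lemma past_word_indep (S : seq E -> bool) (t k : nat) (B : nat -> set E) :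
  P (\bigcap_(s in [set` iota t k]) (a s @^-1` B s) `&`
     [set w | S (past_word (a ^~ w) t)]) =
  (P (\bigcap_(s in [set` iota t k]) (a s @^-1` B s)) *
   (word_expect nu t (fun w => (S w)%:R))%:E)%E.
Proof.
have [a_meas a_law a_indep] := a_iid.
have cap_meas t' k' B' :
    measurable (\bigcap_(s in [set` iota t' k']) (a s @^-1` B' s)).
  by apply: bigcap_measurableType => s _; exact: a_meas.
elim: t S k B => [|t IH] S k B.
  rewrite [X in _ `&` X](_ : _ = [set _ | S [::]]) //=.
  case: (S [::]) => /=; rewrite ?mulr1n ?mulr0n ?mule1 ?mule0.
    by congr (P _); apply/seteqP; split=> w //; case.
  by rewrite -[RHS](measure0 P); congr (P _); apply/seteqP; split=> w [].
(* The cylinder extended to time [t], where the event is fixed to be [e]. *)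
pose B' e s := if s == t then [set e] else B s.
pose A := \bigcap_(s in [set` iota t.+1 k]) (a s @^-1` B s).
have AE e : \bigcap_(s in [set` iota t k.+1]) (a s @^-1` B' e s) =
    A `&` a t @^-1` [set e].
  apply/seteqP; split=> w.
    move=> h; split; last by have := h t; rewrite /B' /= inE eqxx; apply.
    move=> s; rewrite /= mem_iota => /andP[ts sk].
    have := h s; rewrite /B' /= inE mem_iota ts sk orbT gtn_eqF //.
    exact.
  case=> h wt s /=; rewrite inE /B'; case: eqP => [->//|_ /=].
  exact: h.
have -> : A `&` [set w | S (past_word (a ^~ w) t.+1)] =
    \bigcup_(e in [set: E]) (\bigcap_(s in [set` iota t k.+1]) (a s @^-1` B' e s)
      `&` [set w | S (e :: past_word (a ^~ w) t)]).
  rewrite past_word_split setI_bigcupr.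
  by apply: eq_bigcupr => e _; rewrite AE setIA.
have PA e : P (\bigcap_(s in [set` iota t k.+1]) (a s @^-1` B' e s)) =
    ((nu e)%:E * P A)%E.
  rewrite a_indep ?iota_uniq //= big_cons {1}/B' eqxx a_law.
  rewrite /A a_indep ?iota_uniq //; congr (_ * _)%E.
  apply: eq_big_seq => s; rewrite mem_iota /B' => /andP[ts _].
  by rewrite gtn_eqF.
rewrite prob_bigcup_fin; last 2 first.
- move=> e; apply: measurableI; first exact: cap_meas.
  exact: (measurable_past_word (fun w => S (e :: w))).
- move=> e e' _ _ [w]; rewrite !AE /= => -[[[_ <-] _]] [[_ <-] _]; exact: erefl.
(* [P A] is finite, so the remaining computation takes place in [R]. *)
have [x xE] : exists x, P A = x%:E.
  by exists (fine (P A)); rewrite fineK // fin_num_measure //; exact: cap_meas.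
rewrite xE -EFinM mulr_sumr -sumEFin; apply: eq_bigr => e _.
rewrite (IH (fun w => S (e :: w))) PA xE -!EFinM; congr (_%:E).
by rewrite mulrCA mulrA.
Qed.

Lemma past_word_law (S : seq E -> bool) (t : nat) :
  P [set w | S (past_word (a ^~ w) t)] =
  (word_expect nu t (fun w => (S w)%:R))%:E.
Proof.
have := past_word_indep S t 0 (fun=> setT).
rewrite /= set_nil bigcap_set0 setTI probability_setT mul1e.
exact.
Qed.

End IidWords.

Lemma iid_law_ge0 d (T : measurableType d) (R : realType)
    (P : probability T R) (E : finType) (a : nat -> T -> E) (nu : E -> R) :
  iid_with_law P a nu -> forall e, 0 <= nu e.
Proof. by move=> [_ a_law _] e; rewrite -lee_fin -(a_law 0%N). Qed.

(** Total mass one is read off from words of length one, without telescoping the rates along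
    [ell]. *)
Lemma iid_law_sum1 d (T : measurableType d) (R : realType)
    (P : probability T R) (E : finType) (a : nat -> T -> E) (nu : E -> R) :
  iid_with_law P a nu -> \sum_e nu e = 1.
Proof.
move=> a_iid; have := past_word_law a_iid (fun=> true) 1.
rewrite set_true probability_setT => -[->] /=.
by apply: eq_bigr => e _; rewrite mulr1.
Qed.

Lemma eq_word_expect (R : realType) (E : finType) (nu : E -> R) (t : nat)
    (F G : seq E -> R) :
  F =1 G -> word_expect nu t F = word_expect nu t G.
Proof.
elim: t F G => [|t IH] F G FG //=.
by apply: eq_bigr => e _; rewrite (IH _ (fun w => G (e :: w))).
Qed.

Lemma word_expect0 (R : realType) (E : finType) (nu : E -> R) (t : nat) :
  word_expect nu t (fun=> 0) = 0.
Proof. by elim: t => //= t IH; rewrite big1 // => e _; rewrite IH mulr0. Qed.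

(** * Stopping times as series of indicators *)

(** If [m] is the least index in [Q], the terms are 1 before [m] and 0 from [m] on; if [Q] never
    holds, both sides are infinite. *)
Lemma ereal_inf_nat_series (R : realType) (Q : nat -> bool) :
  (forall t, Q t -> Q t.+1) ->
  ereal_inf [set (t%:R : R)%:E | t in [set t | Q t]]%classic =
  (\sum_(0 <= t <oo) (~~ Q t)%:R%:E)%E.
Proof.
move=> Q_up; have Q_mono s t : (s <= t)%N -> Q s -> Q t.
  by move=> /subnK <- Qs; elim: (t - s)%N => //= k; rewrite addSn; exact: Q_up.
have [[t Qt]|noQ] := pselect (exists t, Q t).
  have [m Qm m_min] := ex_minnP (ex_intro _ t Qt).
  transitivity ((m%:R : R)%:E).
    apply/le_anti/andP; split; first by apply: ereal_inf_lbound; exists m.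
    apply: le_ereal_inf_tmp => _ [s Qs <-].
    by rewrite lee_fin ler_nat m_min.
  rewrite (nneseries_split 0 m); last by move=> k _; rewrite lee_fin.
  rewrite add0n [X in (_ + X)%E]eseries0 ?adde0; last first.
    by move=> k mk _; rewrite (Q_mono _ _ mk Qm).
  rewrite (eq_big_nat _ _ (F2 := fun=> 1%:E)).
    by rewrite sumEFin sumr_const_nat subn0.
  move=> k /andP[_ km]; case: (boolP (Q k)) => // /m_min.
  by rewrite leqNgt km.
rewrite [X in ereal_inf X](_ : _ = set0)%classic ?ereal_inf0; last first.
  by apply/seteqP; split=> // x [s Qs _]; apply: noQ; exists s.
(* All terms are 1, so the first [(Num.truncn A).+1] of them already exceed [A]. *)
apply/esym/eqyP => A A_gt0; apply: le_trans (nneseries_lim_ge (Num.truncn A).+1 _).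
  rewrite (eq_big_nat _ _ (F2 := fun=> 1%:E)).
    rewrite sumEFin sumr_const_nat subn0 lee_fin.
    exact: ltW (truncnS_gt _).
  by move=> k _; case: (boolP (Q k)) => // Qk; case: noQ; exists k.
by move=> k _ _; rewrite lee_fin.
Qed.

(** Monotone convergence exchanges integral and series, and the bound on partial sums passes to the
    limit. *)
Lemma integral_stopping_series d (T : measurableType d) (R : realType)
    (P : probability T R) (D : nat -> T -> bool) (p : nat -> R) (M : R) :
  (forall t, measurable [set w | D t w]%classic) ->
  (forall t, P [set w | D t w]%classic = (p t)%:E) ->
  (forall N, \sum_(0 <= t < N) p t <= M) ->
  (\int[P]_w \sum_(0 <= t <oo) (D t w)%:R%:E <= M%:E)%E.
Proof.
move=> D_meas D_prob p_sum.
have DE t w : (D t w)%:R = \1_[set w | D t w]%classic w :> R.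
  by rewrite indicE; congr (_%:R); congr nat_of_bool; apply/idP/idP; rewrite inE.
rewrite integral_nneseries //; last first.
  move=> t; under eq_fun do rewrite DE.
  exact/measurable_realfun.measurable_EFinP/measurable_realfun.measurable_indic.
apply: lime_le.
  by apply: is_cvg_nneseries => t _ _; apply: integral_ge0 => w _; rewrite lee_fin.
apply: nearW => N; rewrite (eq_bigr (fun t => (p t)%:E)); last first.
  move=> t _; under eq_integral do rewrite DE.
  by rewrite integral_indic // setIT; exact: D_prob.
by rewrite sumEFin lee_fin.
Qed.

(** * The dominating chain *)

(* Not truncated at the capacities. *)
Definition bound_step (n : nat) (C : 'I_n -> nat) (e : event C)
    (m : 'I_n -> nat) (i : 'I_n) : nat :=
  match e with
  | inl A => m i + (i \in val A)
  | inr (existT i0 j) => m i - ((j == 0 :> nat) && (i == i0))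
  end.

Definition dominated (n : nat) (C : 'I_n -> nat) (U : {set state C})
    (m : 'I_n -> nat) : Prop :=
  forall x, x \in U -> forall i, (x i <= m i)%N.

(** The start set [U] is a parameter because reading the first letter replaces it by its image. *)
Definition uncoupled (n : nat) (C : 'I_n -> nat)
    (ell : forall i : 'I_n, {perm 'I_(C i).+1}) (U : {set state C})
    (w : seq (event C)) : bool :=
  #|tos_image ell U w| != 1%N.

Lemma tos_image_cons (n : nat) (C : 'I_n -> nat)
    (ell : forall i : 'I_n, {perm 'I_(C i).+1}) (U : {set state C})
    (e : event C) (w : seq (event C)) :
  tos_image ell U (e :: w) = tos_image ell [set tos_step ell x e | x in U] w.
Proof. by rewrite /tos_image -imset_comp. Qed.

(** An older event replaces the full state space by a subset, so the final image can only shrink,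
    and it stays nonempty. *)
Lemma coupled_cons (n : nat) (C : 'I_n -> nat)
    (ell : forall i : 'I_n, {perm 'I_(C i).+1})
    (e : event C) (w : seq (event C)) :
  ~~ uncoupled ell [set: state C] w -> ~~ uncoupled ell [set: state C] (e :: w).
Proof.
rewrite /uncoupled !negbK => /eqP w1; rewrite eqn_leq; apply/andP; split.
  by rewrite -[X in (_ <= X)%N]w1 tos_image_cons subset_leq_card // imsetS.
rewrite card_gt0; apply/set0Pn; exists (tos_word ell (state0 C) (e :: w)).
exact: imset_f.
Qed.

Unset Implicit Arguments.

Section Drift.
Context {R : realType} {n : nat} {C : 'I_n -> nat}.
Context {lam : {set 'I_n} -> R} {mu : forall i : 'I_n, 'I_(C i).+1 -> R}.
Context {ell : forall i : 'I_n, {perm 'I_(C i).+1}}.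
Hypothesis C_gt0 : forall i : 'I_n, (0 < C i)%N.
Hypothesis mu0 : forall i : 'I_n, mu i ord0 = 0.
Hypothesis mu_gt0 :
  forall (i : 'I_n) (x : 'I_(C i).+1), (1 <= x)%N -> 0 < mu i x.
Hypothesis ell_ordering : rate_ordering mu ell.

Lemma ell0 (i : 'I_n) : ell i ord0 = ord0.
Proof.
apply/val_inj/eqP => /=; case: posnP => // /mu_gt0.
rewrite ltNge -(mu0 i) -{2}[ord0](permKV (ell i)).
by rewrite ell_ordering.
Qed.

(** Position 0 of the ordering holds level 0, so a positive level has position at least 1 and is
    counted by [served]. *)
Lemma served_first_gt0 (x : state C) (i : 'I_n) (j : 'I_(C i)) :
  j = 0 :> nat -> (0 < x i)%N -> (0 < served ell x j)%N.
Proof.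
move=> j0 xi; pose k := ((ell i)^-1)%g (x i).
have kE : ell i k = x i by rewrite permKV.
rewrite /served (bigD1 k) ?kE ?eqxx //= j0 lt0n.
apply: contraTneq xi => k0; rewrite -kE (_ : k = ord0) ?ell0 //.
exact: val_inj.
Qed.

(** A demand adds at most one unit to each of its items. The first service lowers every positive
    level and leaves level 0 at 0; other services never raise a level. *)
Lemma tos_step_bound (x : state C) (m : 'I_n -> nat) (e : event C) :
  (forall i, x i <= m i)%N ->
  forall i, (tos_step ell x e i <= bound_step e m i)%N.
Proof.
move=> xm i; case: e => [A | [i0 j]].
  rewrite tos_step_demand /= leq_add //; case: (i \in val A); rewrite ?muln0 //.
  by rewrite muln1; elim/big_rec: _ => // k p _ ?; case: (x k < C k)%N; rewrite ?mul1n.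
rewrite /= ffunE inordK; last first.
  exact: leq_ltn_trans (leq_subr _ _) (ltn_ord _).
case: eqP => [->|_]; last by rewrite muln0 andbF !subn0.
rewrite muln1 andbT; case: eqP => [j0|_]; last first.
  by rewrite subn0; apply: leq_trans (leq_subr _ _) (xm _).
case: (posnP (x i0)) => [->|xi0]; first by rewrite sub0n.
exact: leq_sub (xm _) (served_first_gt0 _ _ _ j0 xi0).
Qed.

Lemma dominated_step (U : {set state C}) (m : 'I_n -> nat) (e : event C) :
  dominated U m ->
  dominated [set tos_step ell x e | x in U] (bound_step e m).
Proof.
by move=> Um _ /imsetP[x xU ->]; apply: tos_step_bound => i; exact: Um.
Qed.

Lemma dominated0_coupled (U : {set state C}) (m : 'I_n -> nat)
    (w : seq (event C)) :
  dominated U m -> U != finset.set0 -> (\sum_i m i = 0)%N -> uncoupled ell U w = false.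
Proof.
move=> Um /set0Pn[y yU] /eqP; rewrite sum_nat_eq0 => /forallP m0.
have U1 x : x \in U -> x = state0 C.
  move=> xU; apply/ffunP => i; apply: val_inj; rewrite ffunE /=.
  by apply/eqP; rewrite -leqn0 -(eqP (implyP (m0 i) isT)) Um.
have -> : U = [set state0 C].
  apply/setP => x; rewrite !inE; apply/idP/eqP => [/U1 //|->].
  by rewrite -(U1 y yU).
by rewrite /uncoupled /tos_image imset_set1 cards1 eqxx.
Qed.

(** * Mean decrease of the dominating chain *)

Definition demand_size (e : event C) : R :=
  if e is inl A then #|val A|%:R else 0.

(** Only the first service of one fixed nonempty item [i0] is credited with a decrease; this
    suffices for the drift. *)
Lemma bound_step_sum (m : 'I_n -> nat) (i0 : 'I_n) (e : event C) :
  (0 < m i0)%N ->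
  (\sum_i bound_step e m i)%N%:R <=
  (\sum_i m i)%N%:R + demand_size e
  - (e == inr (existT _ i0 (Ordinal (C_gt0 i0))))%:R :> R.
Proof.
move=> mi0; case: e => [A | [i j]].
  rewrite [X in (X : bool)%:R](_ : _ = false) // subr0 -natrD ler_nat /=.
  by rewrite big_split leq_add2l -sum1_card [leqRHS]big_mkcond.
case: eqP => [->|_] /=; rewrite addr0; last first.
  by rewrite subr0 ler_nat leq_sum // => k _; exact: leq_subr.
rewrite lerBrDr -natrD ler_nat (bigD1 i0) //= [leqRHS](bigD1 i0) //=.
rewrite eqxx addnAC subnK // leq_add2l leq_sum // => k _.
exact: leq_subr.
Qed.

(** Double counting of the pairs of an item and a demand containing it. *)
Lemma demand_size_mean :
  \sum_(e : event C) event_prob lam mu ell e * demand_size e =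
  (\sum_i arrival lam i) / unif_rate lam mu.
Proof.
rewrite big_sumType /= [X in _ + X]big1 ?addr0; last by move=> ? _; rewrite mulr0.
rewrite -(big_sub (fun A : {set 'I_n} => A != finset.set0)
  (fun A => lam A / unif_rate lam mu * #|A|%:R)) /=.
rewrite mulr_suml; under [RHS]eq_bigr do rewrite /arrival mulr_suml.
rewrite (exchange_big_dep predT) //= big_mkcond; apply: eq_bigr => A _.
rewrite sumr_const -[RHS]mulr_natr.
(* The empty set is not an event, but it contributes 0 to the other side. *)
by case: ifP => // /negbFE/eqP ->; rewrite cards0 mulr0.
Qed.

Lemma unif_rate_gt0 :
  (1 <= n)%N -> (forall A : {set 'I_n}, A != finset.set0 -> 0 <= lam A) ->
  0 < unif_rate lam mu.
Proof.
move=> n_gt0 lam_ge0; rewrite ltr_wpDl ?sumr_ge0 //.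
have mx i : 0 < max_rate mu i.
  apply: lt_le_trans (mu_gt0 i ord_max (C_gt0 i)) _.
  by rewrite /max_rate; apply: le_bigmax_cond => /=.
rewrite (bigD1 (Ordinal n_gt0)) //= ltr_pwDl // sumr_ge0 // => i _.
exact: ltW.
Qed.

Lemma first_service_rate_ge (i : 'I_n) :
  drift lam mu + \sum_i arrival lam i <=
  mu i (ell i (lift ord0 (Ordinal (C_gt0 i)))).
Proof.
pose y := ell i (lift ord0 (Ordinal (C_gt0 i))).
have y_neq0 : y != ord0.
  by rewrite -(ell0 i) (inj_eq perm_inj).
(* The state whose only nonzero level is [y], at item [i]; the cast transports [y] along [k = i]. *)
pose x : state C := [ffun k => if k =P i is ReflectT ki then
  cast_ord (congr1 (fun l => (C l).+1) (esym ki)) y else ord0].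
have xi : x i = y.
  by rewrite ffunE; case: eqP => // ki; apply: val_inj.
have xk k : k != i -> x k = ord0.
  by move=> /negbTE ki; rewrite ffunE; case: eqP ki.
have x_neq0 : x != state0 C.
  by apply: contra_neq y_neq0 => x0; rewrite -xi x0 ffunE.
rewrite subrK; apply: le_trans (bigmin_le_cond _ (service_rate mu) x_neq0) _.
rewrite /service_rate (bigD1 i) //= xi big1 ?addr0 // => k ki.
by rewrite xk.
Qed.

Let nu : event C -> R := event_prob lam mu ell.
Hypothesis n_gt0 : (1 <= n)%N.
Hypothesis lam_ge0 : forall A : {set 'I_n}, A != finset.set0 -> 0 <= lam A.
Hypothesis nu_ge0 : forall e, 0 <= nu e.
Hypothesis nu_sum1 : \sum_e nu e = 1.

Lemma bound_step_drift (m : 'I_n -> nat) (i0 : 'I_n) :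
  (0 < m i0)%N ->
  \sum_e nu e * (\sum_i bound_step e m i)%N%:R <=
  (\sum_i m i)%N%:R - drift lam mu / unif_rate lam mu.
Proof.
move=> mi0; pose e0 : event C := inr (existT _ i0 (Ordinal (C_gt0 i0))).
pose M : R := (\sum_i m i)%N%:R.
apply: (@le_trans _ _
  (\sum_e nu e * (M + demand_size e - (e == e0)%:R))).
  by apply: ler_sum => e _; rewrite ler_wpM2l // bound_step_sum.
under [leLHS]eq_bigr do rewrite mulrBr mulrDr.
rewrite sumrB big_split /= -mulr_suml nu_sum1 mul1r demand_size_mean.
have -> : \sum_e nu e * (e == e0)%:R = nu e0.
  rewrite (bigD1 e0) //= eqxx mulr1 big1 ?addr0 // => e /negbTE ->.
  by rewrite mulr0.
(* For the first service the lower position is 0, of rate 0, so [nu e0] is the rate at position 1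
   divided by [unif_rate lam mu]. *)
rewrite -addrA lerD2l // /nu /= (_ : widen_ord _ _ = ord0); last exact: val_inj.
rewrite ell0 mu0 subr0 -mulrBl -mulNr ler_pM2r ?invr_gt0 ?unif_rate_gt0 //.
rewrite lerBlDr addrC -lerBlDr opprK addrC.
exact: first_service_rate_ge.
Qed.

(** * Summing the tail of the coupling time *)

Hypothesis drift_gt0 : 0 < drift lam mu.

(** First-step analysis: the term [t = 0] costs at most 1, and after a letter [e] the other terms
    form the same series for the image of [U], dominated by [bound_step e m]. The mean decrease of
    the bound pays for the 1. *)
Lemma uncoupled_series_le (N : nat) (U : {set state C}) (m : 'I_n -> nat) :
  dominated U m -> U != finset.set0 ->
  \sum_(0 <= t < N) word_expect nu t (fun w => (uncoupled ell U w)%:R) <=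
  unif_rate lam mu / drift lam mu * (\sum_i m i)%N%:R.
Proof.
have L_gt0 := unif_rate_gt0 n_gt0 lam_ge0.
have K_ge0 : 0 <= unif_rate lam mu / drift lam mu by rewrite ltW // divr_gt0.
elim: N U m => [|N IH] U m Um U0.
  by rewrite big_geq // mulr_ge0.
(* When the dominating point is 0, the set is already a single state and every term vanishes. *)
have [/eqP m0|] := posnP (\sum_i m i)%N.
  rewrite big1; first exact: mulr_ge0.
  move=> t _.
  rewrite (@eq_word_expect _ _ _ _ _ (fun=> 0)) ?word_expect0 // => w.
  by rewrite (dominated0_coupled _ _ _ Um) //; apply/eqP.
rewrite lt0n sum_nat_eq0 negb_forall => /existsP[i0]; rewrite -lt0n => mi0.
rewrite big_nat_recl //= exchange_big /=.
under [X in _ + X]eq_bigr do rewrite -mulr_sumr.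
apply: (@le_trans _ _ (1 + \sum_e nu e *
  (unif_rate lam mu / drift lam mu * (\sum_i bound_step e m i)%N%:R))).
  apply: lerD; first by case: (uncoupled _ _ _).
  apply: ler_sum => e _; apply: ler_wpM2l => //.
  rewrite (eq_bigr (fun t => word_expect nu t (fun w =>
    (uncoupled ell [set tos_step ell x e | x in U] w)%:R))); last first.
    move=> t _; apply: eq_word_expect => w.
    by rewrite /uncoupled tos_image_cons.
  apply: IH; first exact: dominated_step.
  by rewrite imset_eq0.
under [X in 1 + X]eq_bigr do rewrite mulrCA.
rewrite -mulr_sumr; apply: le_trans (_ : 1 + unif_rate lam mu / drift lam mu *
  ((\sum_i m i)%N%:R - drift lam mu / unif_rate lam mu) <= _).
  by rewrite lerD2l ler_wpM2l // (bound_step_drift _ _ mi0).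
(* The factor [unif_rate lam mu / drift lam mu] turns the mean decrease into exactly 1. *)
rewrite mulrBr mulrA mulfVK ?gt_eqF // divff ?gt_eqF //.
by rewrite addrC subrK.
Qed.

End Drift.

Theorem proposition14 (R : realType) (n : nat) (C : 'I_n -> nat)
    (lam : {set 'I_n} -> R)
    (mu : forall i : 'I_n, 'I_(C i).+1 -> R)
    (ell : forall i : 'I_n, {perm 'I_(C i).+1})
    (d : measure_display) (T : measurableType d) (P : probability T R)
    (a : nat -> T -> event C)
    (n_ge1 : (1 <= n)%N)
    (C_gt0 : forall i : 'I_n, (0 < C i)%N)
    (lam_ge0 : forall A : {set 'I_n}, A != finset.set0 -> 0 <= lam A)
    (mu0 : forall i : 'I_n, mu i ord0 = 0)
    (mu_gt0 : forall (i : 'I_n) (x : 'I_(C i).+1), (1 <= x)%N -> 0 < mu i x)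
    (ell_ordering : rate_ordering mu ell)
    (a_iid : iid_with_law P a (event_prob lam mu ell))
    (drift_gt0 : 0 < drift lam mu) :
  (\int[P]_w coupling_time R ell (fun t => a t w)
    <= (unif_rate lam mu / drift lam mu * (\sum_(i < n) C i)%N%:R)%:E)%E.
Proof.
pose unc := uncoupled ell [set: state C].
have -> : (fun w => coupling_time R ell (fun t => a t w)) =
    (fun w => \sum_(0 <= t <oo) (unc (past_word (a ^~ w) t))%:R%:E)%E.
  apply/funext => w.
  (* The series lemma is applied to the coupled times, which are upward closed; hence the double
     negation. *)
  transitivity (\sum_(0 <= t <oo)
    (~~ ~~ unc (past_word (a ^~ w) t))%:R%:E : \bar R)%E.
    rewrite -ereal_inf_nat_series; last first.
      by move=> t; rewrite past_wordS; exact: coupled_cons.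
    rewrite /coupling_time; congr (ereal_inf (image _ _)).
    by apply/seteqP; split=> t /=; rewrite /unc /uncoupled negbK => /eqP.
  by under eq_eseriesr do rewrite negbK.
apply: (integral_stopping_series
  (p := fun t => word_expect (event_prob lam mu ell) t (fun w => (unc w)%:R))).
- by move=> t; exact: (measurable_past_word a_iid).
- by move=> t; exact: (past_word_law a_iid).
(* The full state space is dominated by the capacity vector [C]. *)
move=> N; apply: uncoupled_series_le => //.
- exact: iid_law_ge0 a_iid.
- exact: iid_law_sum1 a_iid.
- by move=> x _ i; rewrite -ltnS.
- by apply/set0Pn; exists (state0 C).
Qed.
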